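(* Let $b \geq 3$ be an integer. If $b \geq 4$, then the equation $$\frac{(1 + s)\zeta_b'(s)}{\zeta_b(s)} - \log\left(\frac{\zeta_b(s)}{b}\right) = 0$$ has a unique solution $s = s_b$ over the positive real numbers. Define $\eta_3 := \log 2/\log 3$ and, for $b \geq 4$, $$\eta_b := 1 + \frac{1}{(1 + s_b)\log b}\log\left(\frac{\zeta_b(s_b)}{b}\right).$$ Then, for every integer $b \geq 3$, $$\#\mathcal{N}_b(x) < x^{\eta_b + o(1)}, \quad \text{as } x \to +\infty.$$
   Context: For an integer $b \geq 2$, every positive integer $n$ has a unique representation $n = \sum_{j=0}^{\ell} d_j b^j$ with $d_0,\dots,d_\ell \in \{0,\dots,b-1\}$ and $d_\ell \neq 0$; the $d_0,\dots,d_\ell$ are the base $b$ digits of $n$. Let $p_b(n)$ be the product of all the base $b$ digits of $n$. For real $x \geq 1$, let $\mathcal{N}_b(x) := \{n \leq x : p_b(n) \mid n\}$, where $n$ ranges over positive integers (if $n$ has a zero digit then $p_b(n)=0$ does not divide $n$). For real $s \geq 0$, let $\zeta_b(s) := \sum_{d=1}^{b-1} d^{-s}$, and let $\zeta_b'$ be its derivative with respect to $s$. $\log$ is the natural logarithm. The notation $f(x) < x^{\eta + o(1)}$ as $x \to +\infty$ (with $b$ fixed) means that there is a function $\varepsilon(x)$ with $\varepsilon(x) \to 0$ as $x \to +\infty$ such that $f(x) < x^{\eta + \varepsilon(x)}$ for all sufficiently large $x$. *)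

(* Defs.v *)
From mathcomp Require Import all_boot all_order all_algebra finmap.
From mathcomp Require Import all_classical all_reals all_analysis.

Set Implicit Arguments.
Unset Strict Implicit.
Unset Printing Implicit Defensive.

Import Order.TTheory GRing.Theory Num.Theory.
Import numFieldNormedType.Exports.

Local Open Scope classical_set_scope.
Local Open Scope ring_scope.

Definition digit (b n j : nat) : nat := ((n %/ b ^ j) %% b)%N.

(* For b >= 2 and n >= 1, trunc_log b n is the index of the leading digit
   of n, so leading zeros are excluded from the product. *)
Definition digit_prod (b n : nat) : nat :=
  (\prod_(j < (trunc_log b n).+1) digit b n j)%N.

Lemma digit_lt (b n j : nat) : (1 < b)%N -> (digit b n j < b)%N.
Proof. by move=> b1; rewrite ltn_mod ltnW. Qed.

Lemma digit_expansion (b n : nat) : (1 < b)%N ->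
  n = (\sum_(j < (trunc_log b n).+1) digit b n j * b ^ j)%N.
Proof.
move=> b1.
have H k : n = (\sum_(j < k) digit b n j * b ^ j + n %/ b ^ k * b ^ k)%N.
  elim: k => [|k IH]; first by rewrite big_ord0 expn0 divn1 muln1.
  rewrite {1}IH big_ord_recr /= -addnA; congr addn.
  by rewrite {1}(divn_eq (n %/ b ^ k) b) mulnDl -divnMA -mulnA -expnS -expnSr addnC.
rewrite {1}(H (trunc_log b n).+1) [X in (_ + X)%N](_ : _ = 0)%N ?addn0 //.
by rewrite divn_small ?trunc_log_ltn.
Qed.

Lemma leading_digit_neq0 (b n : nat) : (1 < b)%N -> (0 < n)%N ->
  digit b n (trunc_log b n) != 0%N.
Proof.
move=> b1 n0; have bn0 : (0 < b ^ trunc_log b n)%N by rewrite expn_gt0 ltnW.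
rewrite /digit modn_small; last by rewrite ltn_divLR // -expnS trunc_log_ltn.
by rewrite -lt0n divn_gt0 // trunc_logP.
Qed.

Definition digit_prod_dvd (R : realType) (b : nat) (x : R) : set nat :=
  [set n | [/\ (0 < n)%N, n%:R <= x & (digit_prod b n %| n)%N]].

Definition zeta (R : realType) (b : nat) (s : R) : R :=
  \sum_(1 <= d < b) (d%:R : R) `^ (- s).

Definition is_saddle (R : realType) (b : nat) (s : R) : Prop :=
  0 < s /\
  (1 + s) * derive1 (@zeta R b) s / zeta b s - ln (zeta b s / b%:R) = 0.

(* The default value 0 of xget is returned only when there is no solution. *)
Definition saddle (R : realType) (b : nat) : R :=
  xget 0 [set s : R | is_saddle b s].

Definition eta_exp (R : realType) (b : nat) : R :=
  if b == 3%N then ln 2 / ln 3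
  else let s := saddle R b in
       1 + ((1 + s) * ln b%:R)^-1 * ln (zeta b s / b%:R).

(* f(x) < x^(e + o(1)) as x -> +oo *)
Definition lt_pow_o1 (R : realType) (f : R -> R) (e : R) : Prop :=
  exists eps : R -> R,
    eps x @[x --> +oo] --> (0 : R) /\
    \forall x \near +oo, f x < x `^ (e + eps x).

(* Main.v *)
Require Import Defs.
From mathcomp Require Import all_boot all_order all_algebra finmap.
From mathcomp Require Import all_classical all_reals all_analysis.
From mathcomp Require Import ring lra zify.

(* Fix [s >= 0] and a threshold [y = x ^ (1 - eta)].  The counted integers with
   [p(n) <= y] number at most the sum of [(y / p(n)) ^ s] over all strings of
   [N ~ log x / log b] nonzero digits (Rankin), which is essentially
   [y ^ s * zeta s ^ N].  Those with [p(n) > y] are multiples of [p(n)], and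
   [p(n)] takes at most [(N + 1) ^ b] values, each having at most [x / y]
   multiples.  The two bounds agree, up to powers of [log x], for
   [eta = 1 + log (zeta s / b) / ((1 + s) log b)].  Any [s >= 0] gives a valid
   exponent; [s = 0] gives [eta_3].

   With [L = log zeta], which is strictly convex, the saddle-point function is
   [F s = (1 + s) L' s - L s + log b], and [s < t] implies [F s < F t] by
   comparing the tangents to [L] at [s] and [t].  Moreover [F 0 < 0] for
   [b >= 4], and [F] is positive far out since [L] decays exponentially. *)

Import Order.TTheory GRing.Theory Num.Theory.
Import numFieldNormedType.Exports.

Local Open Scope ring_scope.

(** * Digit strings and their products *)

Lemma digit0 (b m d : nat) : (d < b)%N -> digit b (m * b + d) 0 = d.
Proof. by move=> db; rewrite /digit expn0 divn1 modnMDl modn_small. Qed.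

Lemma digitS (b m d j : nat) : (d < b)%N ->
  digit b (m * b + d) j.+1 = digit b m j.
Proof.
move=> db; rewrite /digit expnS divnMA divnMDl ?(leq_ltn_trans _ db) //.
by rewrite (divn_small db) addn0.
Qed.

Lemma trunc_log_cons (b m d : nat) : (1 < b)%N -> (0 < m)%N -> (d < b)%N ->
  trunc_log b (m * b + d) = (trunc_log b m).+1.
Proof.
move=> b1 m0 db; apply: trunc_log_eq => //.
have /andP[lo hi] : (b ^ trunc_log b m <= m < b ^ (trunc_log b m).+1)%N.
  by rewrite trunc_logP // trunc_log_ltn.
rewrite !(expnSr b); apply/andP; split; first by nia.
by move: hi db; rewrite expnSr; nia.
Qed.

Lemma digit_prod_cons (b m d : nat) : (1 < b)%N -> (0 < m)%N -> (d < b)%N ->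
  digit_prod b (m * b + d) = (digit_prod b m * d)%N.
Proof.
move=> b1 m0 db; rewrite /digit_prod trunc_log_cons // big_ord_recl digit0 //.
by rewrite mulnC; congr (_ * _)%N; apply: eq_bigr => j _; rewrite /= digitS.
Qed.

(** The case [d = 0] is included: [trunc_log b 0 = 0], so 0 is read as the single digit 0 and its
    product is 0. *)
Lemma digit_prod_digit (b d : nat) : (1 < b)%N -> (d < b)%N ->
  digit_prod b d = d.
Proof.
move=> b1 db; have t0 : trunc_log b d = 0%N.
  by apply/eqP; rewrite trunc_log_eq0; lia.
by rewrite /digit_prod t0 big_ord1 /digit expn0 divn1 modn_small.
Qed.

Lemma sum_digit_cons (V : nmodType) (b M : nat) (F : nat -> V) :
  \sum_(0 <= n < M * b) F n =
  \sum_(0 <= m < M) \sum_(0 <= d < b) F (m * b + d)%N.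
Proof.
rewrite big_nat_mul; apply: eq_bigr => m _.
rewrite -{1}[(m * b)%N]add0n big_addn mulSn addnK.
by apply: eq_bigr => d _; rewrite addnC.
Qed.

(** Expanding the [k]-th power over strings of [k] digits gives the integers with exactly [k]
    digits; [g 0 = 0] kills every string containing a zero. The induction on [N] splits off the last
    digit. *)
Lemma sum_digit_prod (R : realFieldType) (g : nat -> R) (b N : nat) :
  (1 < b)%N -> g 0 = 0 -> (forall m n, g (m * n)%N = g m * g n) ->
  \sum_(1 <= n < b ^ N) g (digit_prod b n) =
  \sum_(1 <= k < N.+1) (\sum_(1 <= d < b) g d) ^+ k.
Proof.
move=> b1 g0 gM; set Z := \sum_(1 <= d < b) g d.
have ZE : \sum_(0 <= d < b) g d = Z by rewrite big_ltn ?(ltnW b1)// g0 add0r.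
elim: N => [|N IH]; first by rewrite expn0 !big_geq.
have bN0 : (0 < b ^ N)%N by rewrite expn_gt0 ltnW.
have S0 M : (0 < M)%N ->
    \sum_(1 <= n < M) g (digit_prod b n) = \sum_(0 <= n < M) g (digit_prod b n).
  by move=> M0; rewrite [RHS]big_ltn // digit_prod_digit ?(ltnW b1)// g0 add0r.
rewrite S0 ?expn_gt0 ?(ltnW b1)// expnSr sum_digit_cons big_ltn //.
(* The quotient 0 leaves the one-digit integers, which the recursion on the last digit does not
   cover. *)
have -> : \sum_(0 <= d < b) g (digit_prod b (0 * b + d)) = Z.
  rewrite -ZE; apply: eq_big_nat => d /andP[_ db].
  by rewrite mul0n add0n digit_prod_digit.
have -> : \sum_(1 <= m < b ^ N) \sum_(0 <= d < b) g (digit_prod b (m * b + d))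
    = (\sum_(1 <= k < N.+1) Z ^+ k) * Z.
  rewrite -IH mulr_suml; apply: eq_big_nat => m /andP[m0 _].
  rewrite -ZE mulr_sumr; apply: eq_big_nat => d /andP[_ db].
  by rewrite digit_prod_cons.
rewrite [RHS]big_ltn // expr1; congr (_ + _).
rewrite -[in RHS](addn1 1%N) -(addn1 N.+1) big_addn addnK mulr_suml.
by apply: eq_bigr => k _; rewrite addn1 exprSr.
Qed.

(** The product depends only on how often each digit occurs, so it takes at most [N.+1 ^ b]
    values. *)
Lemma digit_prod_exponents (b N n : nat) : (1 < b)%N -> (n < b ^ N)%N ->
  (0 < n)%N ->
  exists e : {ffun 'I_b -> 'I_N.+1}, digit_prod b n = (\prod_(d < b) d ^ e d)%N.
Proof.
move=> b1 nbN n0; set k := (trunc_log b n).+1.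
have kN : (k <= N)%N.
  rewrite /k -(ltn_exp2l _ _ b1); apply: leq_ltn_trans nbN.
  by rewrite trunc_logP.
pose D (j : 'I_k) : 'I_b := Ordinal (@digit_lt b n j b1).
(* [inord] does not truncate here: a digit occurs at most [k <= N] times. *)
exists [ffun d => inord #|[pred j | D j == d]|].
rewrite /digit_prod -/k (partition_big D xpredT) //=.
apply: eq_bigr => d _; rewrite ffunE inordK; last first.
  by rewrite ltnS (leq_trans (max_card _)) // card_ord.
by rewrite -prod_nat_const; apply: eq_big => [j|j /eqP <-]; rewrite ?inE.
Qed.

(** * The counting bound with a free threshold *)

Lemma card_fset_set_le (R : numDomainType) (A : set nat) (M : nat) (c : nat -> R) :
  (forall n, A n -> (0 < n < M)%N) ->
  (forall n, A n -> 1 <= c n) -> (forall n, 0 <= c n) ->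
  (#|` fset_set A|%fset)%:R <= \sum_(1 <= n < M) c n.
Proof.
move=> AM c1 c0.
(* Membership in [fset_set A] reflects [A] only once [A] is known to be finite. *)
have fA : finite_set A.
  apply: (sub_finite_set (B := `I_M)) (finite_II _) => n /AM /andP[]//.
have P : perm_eq (enum_fset (fset_set A)) [seq n <- index_iota 1 M | n \in A].
  apply: uniq_perm; [exact: fset_uniq|by rewrite filter_uniq // iota_uniq|].
  move=> n; rewrite mem_filter mem_index_iota -/(n \in fset_set A).
  rewrite in_fset_set //; apply/idP/andP => [nA|[]//].
  by split=> //; apply: AM; rewrite inE in nA.
rewrite -sum1_size natr_sum (perm_big _ P) /= big_filter big_mkcond /=.
apply: ler_sum => n _; case: ifP => [|//]; rewrite inE => An.
by rewrite c1.
Qed.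

Lemma sum_dvd_le (R : realFieldType) (d X : nat) : (0 < d)%N ->
  \sum_(1 <= n < X.+1) ((d %| n)%:R : R) <= X%:R / d%:R.
Proof.
move=> d0; rewrite -natr_sum -divn_count_dvd ler_pdivlMr ?ltr0n //.
by rewrite -natrM ler_nat leq_trunc_div.
Qed.

Lemma card_digit_prod_dvd_le (R : realType) (b N : nat) (x s y : R) :
  (1 < b)%N -> 0 <= x -> x < (b ^ N)%:R -> 0 <= s -> 0 < y ->
  (#|` fset_set (digit_prod_dvd b x)|%fset)%:R <=
  y `^ s * (N%:R * zeta b s ^+ N) + N.+1%:R ^+ b * (x / y).
Proof.
move=> b1 x0 xbN s0 y0.
(* The Rankin weight is set to 0 at 0 by hand: the power of 0 with exponent 0 is 1, yet a zero digit
   must contribute nothing even when [s = 0]. *)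
pose g (k : nat) : R := if k == 0%N then 0 else k%:R `^ (- s).
pose P (e : {ffun 'I_b -> 'I_N.+1}) := (\prod_(d < b) d ^ e d)%N.
pose B n e : R := ((y < (P e)%:R) && (n%:R <= x) && (P e %| n)%N)%:R.
have g_ge0 k : 0 <= g k by rewrite /g; case: ifP => // _; exact: powR_ge0.
have gM m n : g (m * n)%N = g m * g n.
  rewrite /g muln_eq0; case: eqP => _ /=; first by rewrite mul0r.
  by case: eqP => _ /=; rewrite ?mulr0 // natrM powRM.
have gZ : \sum_(1 <= d < b) g d = zeta b s.
  by apply: eq_big_nat => -[|d] // _.
have Z1 : 1 <= zeta b s :> R.
  rewrite /zeta big_ltn // powR1 lerDl.
  by apply: sumr_ge0 => d _; exact: powR_ge0.
(* On the counted set the first term is at least 1 when the product is at most [y]; otherwise some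
   [B n e] equals 1. *)
pose c n : R := y `^ s * (g (digit_prod b n) * (n < b ^ N)%:R) + \sum_e B n e.
have c0 n : 0 <= c n.
  by rewrite addr_ge0 ?mulr_ge0 ?powR_ge0 ?ler0n // sumr_ge0.
set X := Num.trunc x.
have XbN : (X < b ^ N)%N by rewrite truncn_lt_nat.
have H : (#|` fset_set (digit_prod_dvd b x)|%fset)%:R <= \sum_(1 <= n < X.+1) c n.
  apply: card_fset_set_le => // n [n0 nx pn].
    by rewrite n0 ltnS truncn_ge_nat.
  have nX : (n <= X)%N by rewrite truncn_ge_nat.
  have nbN := leq_ltn_trans nX XbN.
  have p0 : digit_prod b n != 0%N.
    by apply: contraTneq pn => ->; rewrite dvd0n -lt0n.
  rewrite /c nbN mulr1; case: (leP (digit_prod b n)%:R y) => [py|yp].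
    rewrite ler_wpDr ?sumr_ge0 // /g (negbTE p0) powRN.
    rewrite ler_pdivlMr ?powR_gt0 ?ltr0n ?lt0n // mul1r.
    by rewrite ge0_ler_powR ?nnegrE // ltW.
  have [e pe] := digit_prod_exponents _ _ _ b1 nbN n0.
  rewrite ler_wpDl ?mulr_ge0 ?powR_ge0 // (bigD1 e) //= ler_wpDr ?sumr_ge0 //.
  by rewrite /B /P -pe yp nx pn.
apply: le_trans H _; rewrite /c big_split /= lerD //.
  rewrite -mulr_sumr ler_wpM2l ?powR_ge0 //.
  apply: (@le_trans _ _ (\sum_(1 <= n < b ^ N) g (digit_prod b n))).
    rewrite [leRHS](@big_cat_nat _ _ _ X.+1) //= ler_wpDr ?sumr_ge0 //.
    by apply: ler_sum => n _; case: (_ < _)%N; rewrite ?mulr1 ?mulr0.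
  rewrite sum_digit_prod // gZ.
  (* As [zeta b s >= 1], each power is at most the [N]-th. *)
  apply: (@le_trans _ _ (\sum_(1 <= k < N.+1) zeta b s ^+ N)).
    rewrite !big_nat; apply: ler_sum => k /andP[_ kN].
    by rewrite ler_weXn2l.
  by rewrite sumr_const_nat subn1 /= mulr_natl.
rewrite exchange_big /=.
(* If [P e > y], its multiples up to [x] number at most [x / P e <= x / y]; otherwise all [B n e]
   vanish. *)
apply: (@le_trans _ _ (\sum_(e : {ffun 'I_b -> 'I_N.+1}) x / y)).
  apply: ler_sum => e _; rewrite /B.
  case: (ltP y (P e)%:R) => [yP|_] /=; last first.
    by rewrite sumr_const_nat mul0rn divr_ge0 // ltW.
  have P0 : (0 < P e)%N by rewrite -(ltr0n R) (lt_trans y0).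
  apply: (@le_trans _ _ (\sum_(1 <= n < X.+1) ((P e %| n)%:R : R))).
    by apply: ler_sum => n _; case: (_ <= x).
  apply: le_trans (sum_dvd_le _ _ _ P0) _.
  by rewrite ler_pM ?invr_ge0 ?ler0n // ?truncn_le // lef_pV2 ?posrE ?ltr0n // ltW.
by rewrite sumr_const card_ffun !card_ord -[leLHS]mulr_natl natrX.
Qed.

(** * Derivatives of [zeta] and convexity of its logarithm *)

(** Arbitrary coefficients make the family closed under differentiation, so one formula yields both
    the derivative of [zeta] and the continuity of that derivative. *)
Definition dirichlet_sum (R : realType) (a : nat -> R) (b : nat) (s : R) : R :=
  \sum_(1 <= d < b) a d * d%:R `^ (- s).

Lemma is_derive_dirichlet_sum (R : realType) (a : nat -> R) (b : nat) (s : R) :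
  is_derive s 1 (dirichlet_sum R a b) (dirichlet_sum R (fun d => - (a d * ln d%:R)) b s).
Proof.
have -> : dirichlet_sum R a b =
    \sum_(i < b.-1) (fun u : R => a i.+1 * expR (- (ln i.+1%:R * u))).
  apply/funext => u; rewrite fct_sumE /dirichlet_sum big_add1 big_mkord.
  by apply: eq_bigr => i _; rewrite /powR pnatr_eq0 /= mulNr [u * _]mulrC.
rewrite /dirichlet_sum big_add1 big_mkord.
apply: is_derive_sum => i; set c := ln _.
have Dc : is_derive s 1 (fun u : R => - (c * u)) (- (c *: 1)).
  exact: (is_deriveN (is_deriveZ c (is_derive_id s 1))).
have Dg := @is_derive1_comp R expR (fun u => - (c * u)) s _ _ (is_derive_expR _) Dc.
have De := is_deriveZ (a i.+1) Dg.
apply: is_derive_eq De _.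
rewrite /GRing.scale /= /powR pnatr_eq0 /= -/c.
have -> : - s * c = - (c * s) by ring.
by ring.
Qed.

Lemma zetaE (R : realType) (b : nat) :
  @zeta R b = dirichlet_sum R (fun=> 1) b.
Proof.
by apply/funext => s; apply: eq_bigr => d _; rewrite mul1r.
Qed.

Lemma derive1_zeta (R : realType) (b : nat) (s : R) :
  derive1 (@zeta R b) s = dirichlet_sum R (fun d => - ln d%:R) b s.
Proof.
rewrite derive1E zetaE; have D := is_derive_dirichlet_sum R (fun=> 1) b s.
by rewrite derive_val; apply: eq_bigr => d _; rewrite mul1r.
Qed.

Lemma zeta_ge1 (R : realType) (b : nat) (s : R) : (1 < b)%N -> 1 <= zeta b s.
Proof.
move=> b1; rewrite /zeta big_ltn // powR1 lerDl.
by apply: sumr_ge0 => d _; exact: powR_ge0.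
Qed.

Lemma derive1_zeta_lt0 (R : realType) (b : nat) (s : R) : (3 <= b)%N ->
  derive1 (@zeta R b) s < 0.
Proof.
move=> b3; rewrite derive1_zeta /dirichlet_sum.
rewrite big_ltn ?(ltnW b3) // ln1 oppr0 mul0r add0r big_ltn // ltr_wnDr //.
  rewrite big_nat; apply: sumr_le0 => d /andP[d3 _].
  rewrite mulNr oppr_le0 mulr_ge0 ?powR_ge0 // ln_ge0 // ler1n.
  exact: leq_trans d3.
by rewrite mulNr oppr_lt0 mulr_gt0 ?powR_gt0 ?ltr0n // ln_gt0 // ltr1n.
Qed.

(* Strict convexity of [ln (zeta b _)], through [1 + u <= expR u] applied to
   each summand around the mean of the logarithms of the digits. *)
Lemma ln_zeta_tangent (R : realType) (b : nat) (s t : R) : (3 <= b)%N ->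
  s != t ->
  ln (zeta b t) + (s - t) * (derive1 (@zeta R b) t / zeta b t) < ln (zeta b s).
Proof.
move=> b3 st; set Z := zeta b t; set u := _ / Z.
have b1 : (1 < b)%N by apply: leq_trans b3.
have Z0 : 0 < Z by exact: lt_le_trans (zeta_ge1 R b t b1).
have u0 : u < 0 by rewrite pmulr_llt0 ?invr_gt0 // derive1_zeta_lt0.
have h0 : s - t != 0 by rewrite subr_eq0.
set h := s - t in h0 *.
have tE d : (0 < d)%N ->
    d%:R `^ (- s) = d%:R `^ (- t) * (expR (h * u) * expR (- h * (ln d%:R + u))).
  move=> d0; rewrite -expRD /powR pnatr_eq0.
  case: d d0 => // d _ /=; rewrite -expRD; congr expR; rewrite /h; ring.
suff H : expR (h * u) * Z < zeta b s.
  rewrite addrC -(expRK (h * u)) -lnM ?posrE ?expR_gt0 // ltr_ln ?posrE //.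
    by rewrite mulr_gt0 ?expR_gt0.
  exact: lt_le_trans (zeta_ge1 R b s b1).
(* [- u] is the mean of [ln d] with weights [d ^ (- t)], so the linear terms sum to zero. *)
have -> : expR (h * u) * Z = \sum_(1 <= d < b)
    d%:R `^ (- t) * (expR (h * u) * (1 + - h * (ln d%:R + u))).
  have E : \sum_(1 <= d < b) - ln d%:R * d%:R `^ (- t) = u * Z.
    by rewrite /u divfK ?gt_eqF // derive1_zeta.
  transitivity (expR (h * u) * ((1 - h * u) * Z + h * (u * Z))); first by ring.
  rewrite -E /Z /zeta !mulr_sumr -big_split mulr_sumr /=.
  by apply: eq_bigr => d _; ring.
(* Strictness comes from [d = 1], where the exponent is [- h * u], which is nonzero. *)
rewrite /zeta big_ltn // [ltRHS]big_ltn // ltr_leD //.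
  rewrite [ltRHS]tE // ln1 powR1 !mul1r add0r ltr_pM2l ?expR_gt0 //.
  by rewrite expR_gt1Dx // mulf_neq0 ?oppr_eq0 // lt_eqF.
rewrite !big_nat; apply: ler_sum => d /andP[d1 _].
rewrite tE; last exact: leq_trans d1.
by rewrite ler_wpM2l ?powR_ge0 // ler_wpM2l ?expR_ge0 // expR_ge1Dx.
Qed.

(** * The saddle-point equation *)

Definition saddle_fun (R : realType) (b : nat) (s : R) : R :=
  (1 + s) * derive1 (@zeta R b) s / zeta b s - ln (zeta b s / b%:R).

Lemma saddle_funE (R : realType) (b : nat) (s : R) : (1 < b)%N ->
  saddle_fun R b s =
  (1 + s) * (derive1 (@zeta R b) s / zeta b s) - ln (zeta b s) + ln b%:R.
Proof.
move=> b1; rewrite /saddle_fun ln_div ?posrE ?ltr0n ?(ltnW b1) //.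
  by rewrite mulrA; ring.
exact: lt_le_trans (zeta_ge1 R b s b1).
Qed.

(** Let [u < v] be the slopes of [L = ln zeta] at [s] and [t]. The tangent at [t], evaluated at [s],
    bounds the increment of [saddle_fun] below by [(1 + s) * (v - u)]. *)
Lemma saddle_fun_lt (R : realType) (b : nat) (s t : R) : (3 <= b)%N ->
  0 <= s -> s < t -> saddle_fun R b s < saddle_fun R b t.
Proof.
move=> b3 s0 st; have b1 : (1 < b)%N by apply: leq_trans b3.
rewrite !saddle_funE //.
have := ln_zeta_tangent R b s t b3 (negbT (lt_eqF st)).
have := ln_zeta_tangent R b t s b3 (negbT (gt_eqF st)).
set u := _ / zeta b s; set v := _ / zeta b t => H1 H2.
have uv : u < v by rewrite -(ltr_pM2l (x := t - s)) ?subr_gt0 //; lra.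
have : 0 <= (1 + s) * (v - u) by rewrite mulr_ge0 //; lra.
lra.
Qed.

(** This is [ln (1 + x) <= x] at [x = -1/2]. With the next bound it gives [ln 2 + ln 3 >= 7/6 > 1],
    the margin needed at [s = 0]. *)
Lemma ln2_ge (R : realType) : 2^-1 <= ln 2 :> R.
Proof.
have : ln 2^-1 <= - 2^-1 :> R.
  have := @le_ln1Dx R (- 2^-1); have -> : 1 + - 2^-1 = 2^-1 :> R by field.
  by apply; lra.
by rewrite lnV ?posrE //; lra.
Qed.

Lemma ln3_ge (R : realType) : 2 / 3 <= ln 3 :> R.
Proof.
have : ln 3^-1 <= - (2 / 3) :> R.
  have := @le_ln1Dx R (- (2 / 3)); have -> : 1 + - (2 / 3) = 3^-1 :> R by field.
  by apply; lra.
by rewrite lnV ?posrE //; lra.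
Qed.

(** The value is [zeta' 0 / (b - 1) + ln (b / (b - 1))]. The logarithm is at most [1 / (b - 1)],
    while the digits 2 and 3, both present when [b >= 4], already force [zeta' 0 <= - 7/6]. *)
Lemma saddle_fun0_lt0 (R : realType) (b : nat) : (4 <= b)%N ->
  saddle_fun R b 0 < 0.
Proof.
move=> b4; have b1 : (1 < b)%N by apply: leq_trans b4.
have Z0 : zeta b 0 = b.-1%:R :> R.
  rewrite /zeta -subn1 -sumr_const_nat; apply: eq_bigr => d _.
  by rewrite oppr0 powRr0.
have c0 : 0 < b.-1%:R :> R by rewrite ltr0n; lia.
have bE : b%:R = b.-1%:R + 1 :> R by rewrite natr1 prednK // ltnW.
have D0 : derive1 (@zeta R b) 0 <= - (7 / 6).
  rewrite derive1_zeta /dirichlet_sum oppr0 big_ltn // ln1 oppr0 mul0r add0r.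
  rewrite big_ltn ?(leq_trans _ b4) // big_ltn // !powRr0 !mulr1.
  have : \sum_(4 <= d < b) - ln d%:R * d%:R `^ 0 <= 0 :> R.
    rewrite big_nat; apply: sumr_le0 => d /andP[d4 _].
    rewrite powRr0 mulr1 oppr_le0 ln_ge0 // ler1n; exact: leq_trans d4.
  by have := ln2_ge R; have := ln3_ge R; lra.
have L : ln (b%:R / b.-1%:R) <= b.-1%:R^-1 :> R.
  rewrite bE mulrDl divff ?gt_eqF // mul1r le_ln1Dx //.
  by rewrite (lt_trans (ltrN10 R)) ?invr_gt0.
rewrite saddle_funE // Z0 addr0 mul1r.
move: L; rewrite ln_div ?posrE ?ltr0n ?(ltnW b1) //; last by lia.
have : derive1 (@zeta R b) 0 / b.-1%:R <= - (7 / 6) / b.-1%:R.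
  by rewrite ler_wpM2r // invr_ge0 ltW.
have : 0 < b.-1%:R^-1 :> R by rewrite invr_gt0.
lra.
Qed.

Lemma zeta_nat_le (R : realType) (b m : nat) : (1 < b)%N ->
  zeta b m%:R <= 1 + b%:R / 2 ^+ m :> R.
Proof.
move=> b1; rewrite /zeta big_ltn // powR1 lerD2l.
apply: (@le_trans _ _ (\sum_(2 <= d < b) (2 ^- m : R))).
  rewrite !big_nat; apply: ler_sum => d /andP[d2 _].
  rewrite powR_invn ?ler0n // lef_pV2 ?posrE ?exprn_gt0 ?ltr0n //; last first.
    exact: leq_trans d2.
  by rewrite lerXn2r ?nnegrE ?ler0n // ler_nat.
rewrite sumr_const_nat -[leLHS]mulr_natl ler_wpM2r ?invr_ge0 ?exprn_ge0 //.
by rewrite ler_nat leq_subr.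
Qed.

(** The tangent to [L = ln zeta] at [2 * m], evaluated at [m], turns smallness of [L m] into
    smallness of [m] times the slope at [2 * m]; then [ln b] dominates. *)
Lemma saddle_fun_gt0 (R : realType) (b : nat) : (3 <= b)%N ->
  exists2 M : R, 0 <= M & 0 < saddle_fun R b M.
Proof.
move=> b3; have b1 : (1 < b)%N by apply: leq_trans b3.
(* Since [6 * b = m < 2 ^ m], the tail bound [b / 2 ^ m] is at most [1/6]. *)
pose m := (6 * b)%N; have m0 : 1 <= m%:R :> R by rewrite ler1n /m; lia.
exists (2 * m%:R); first lra.
have mne : m%:R != 2 * m%:R :> R by apply/eqP; lra.
have T := ln_zeta_tangent R b m%:R (2 * m%:R) b3 mne.
have lnZ (s : R) : 0 <= ln (zeta b s) by rewrite ln_ge0 // zeta_ge1.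
have := lnZ (2 * m%:R).
rewrite saddle_funE //; move: T; set v := _ / zeta b (2 * m%:R) => T L2.
have v0 : v < 0.
  rewrite /v pmulr_llt0 ?invr_gt0 ?derive1_zeta_lt0 //.
  exact: lt_le_trans (zeta_ge1 R b _ b1).
have Lm : ln (zeta b m%:R) <= 6^-1 :> R.
  have Zm := zeta_nat_le R b m b1.
  apply: (@le_trans _ _ (zeta b m%:R - 1)).
    have := @le_ln1Dx R (zeta b m%:R - 1); rewrite [1 + _]addrC subrK; apply.
    by have := zeta_ge1 R b m%:R b1; lra.
  rewrite lerBlDl (le_trans Zm) // lerD2l ler_pdivrMr ?exprn_gt0 //.
  rewrite ler_pdivlMl // -natrM -natrX ler_nat.
  by rewrite -/m ltnW // ltn_expl.
have lnb : 2^-1 < ln b%:R :> R.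
  apply: (le_lt_trans (ln2_ge R)).
  by rewrite ltr_ln ?posrE ?ltr0n ?ltr_nat // ltnW.
(* Hence [v >= m * v > - 1/6], and the total loss stays below [1/6 + 1/6 + 1/6 = 1/2 < ln b]. *)
have : (1 - m%:R) * v >= 0 by rewrite mulr_le0 //; lra.
lra.
Qed.

Lemma continuous_saddle_fun (R : realType) (b : nat) : (1 < b)%N ->
  continuous (saddle_fun R b).
Proof.
move=> b1 s.
have cD (a : nat -> R) : {for s, continuous (dirichlet_sum R a b)}.
  apply: differentiable_continuous; apply/derivable1_diffP.
  exact: (@ex_derive _ _ _ _ _ _ _ (is_derive_dirichlet_sum R a b s)).
have Z0 : 0 < zeta b s by exact: lt_le_trans (zeta_ge1 R b s b1).
have cZ : {for s, continuous (@zeta R b)} by rewrite zetaE.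
have -> : saddle_fun R b = (fun s =>
  (1 + s) * (dirichlet_sum R (fun d => - ln d%:R) b s / zeta b s)
   - ln (zeta b s) + ln b%:R).
  by apply/funext => t; rewrite saddle_funE // derive1_zeta.
apply: cvgD; last exact: cvg_cst.
apply: cvgB.
  apply: cvgM; first by apply: cvgD; [exact: cvg_cst|exact: cvg_id].
  by apply: cvgM; [exact: cD|apply: cvgV; rewrite ?gt_eqF].
exact: (continuous_comp cZ (continuous_ln Z0)).
Qed.

Lemma exists_unique_saddle (R : realType) (b : nat) : (4 <= b)%N ->
  exists! s : R, is_saddle b s.
Proof.
move=> b4; have b3 : (3 <= b)%N by apply: leq_trans b4.
have b1 : (1 < b)%N by apply: leq_trans b4.
have [M M0 FM] := saddle_fun_gt0 R b b3.
have F0 := saddle_fun0_lt0 R b b4.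
have [] := @IVT R (saddle_fun R b) 0 M 0 M0.
- exact/continuous_subspaceT/continuous_saddle_fun.
- by rewrite ge_min (ltW F0) le_max (ltW FM) orbT.
move=> s; rewrite in_itv /= => /andP[s0 _] Fs.
(* The intermediate value theorem gives only [0 <= s]; the negative value at 0 excludes equality. *)
have sp : 0 < s.
  by rewrite lt_def s0 andbT; apply: contraTneq F0 => s_0; rewrite -s_0 Fs s_0 ltxx.
exists s; split=> [//|t [t0 Ft]].
have {}Ft : saddle_fun R b t = 0 by [].
have [st|ts|//] := ltgtP s t.
  by have := saddle_fun_lt R b s t b3 s0 st; rewrite Fs Ft ltxx.
by have := saddle_fun_lt R b t s b3 (ltW t0) ts; rewrite Fs Ft ltxx.
Qed.

(** * Choosing the threshold and absorbing logarithms *)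

Lemma lt_pow_o1_polylog (R : realType) (f : R -> R) (C K e : R) (k : nat) :
  1 <= C -> 1 <= K ->
  (forall x, expR 1 <= x -> f x <= C * (K * ln x) ^+ k * x `^ e) ->
  lt_pow_o1 f e.
Proof.
move=> C1 K1 fle; have C0 : 0 < C by lra. have K0 : 0 < K by lra.
have lnC : 0 <= ln C by exact: ln_ge0.
have lnK0 : 0 <= ln K *+ k by rewrite mulrn_wge0 // ln_ge0.
(* With [S = sqrt (ln x) >= 1], the factor [x ^ eps] is [exp (A * S)]. The summand [2 *+ k] pays for
   [(ln x) ^ k] through [ln S < S], and the final 1 makes the inequality strict. *)
pose A := ln C + ln K *+ k + 2 *+ k + 1.
have A0 : 0 < A by rewrite /A; have : 0 <= 2 *+ k :> R by []; lra.
exists (fun x => A / Num.sqrt (ln x)); split.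
  apply/cvgrPdist_lt => d d0; near=> x.
  have x0 : 0 < x by near: x; apply: nbhs_pinfty_gt; exact: num_real.
  have Ax : (A / d) ^+ 2 < ln x.
    by rewrite -(expRK ((A / d) ^+ 2)) ltr_ln ?posrE ?expR_gt0 //.
  have Ads : A / d < Num.sqrt (ln x).
    rewrite -[ltLHS]gtr0_norm ?divr_gt0 // -sqrtr_sqr ltr_sqrt //.
    by apply: le_lt_trans Ax; exact: sqr_ge0.
  have s0 : 0 < Num.sqrt (ln x) by apply: lt_trans Ads; rewrite divr_gt0.
  rewrite sub0r normrN gtr0_norm ?divr_gt0 // ltr_pdivrMr //.
  by rewrite mulrC -ltr_pdivrMr.
near=> x; have xe : expR 1 <= x by near: x; apply: nbhs_pinfty_ge; exact: num_real.
have x0 : 0 < x by exact: lt_le_trans (expR_gt0 1) xe.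
have L1 : 1 <= ln x by rewrite -(expRK 1) ler_ln ?posrE ?expR_gt0.
have S1 : 1 <= Num.sqrt (ln x) by rewrite -[leLHS]sqrtr1 ler_sqrt //; lra.
have SE := sqr_sqrtr (le_trans ler01 L1).
set S := Num.sqrt (ln x) in S1 SE *; have S0 : 0 < S by lra.
apply: (le_lt_trans (fle x xe)).
rewrite powRD; last by rewrite (gt_eqF x0) implybT.
rewrite mulrC ltr_pM2l ?powR_gt0 //.
have KL : 0 < K * ln x by rewrite mulr_gt0 //; lra.
rewrite -ltr_ln ?posrE ?mulr_gt0 ?exprn_gt0 ?powR_gt0 //.
rewrite ln_powR lnM ?posrE ?exprn_gt0 // lnXn // lnM ?posrE //; last by lra.
rewrite -SE lnXn // expr2 mulrA divfK ?gt_eqF //.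
have H : ln S *+ 2 *+ k <= 2 *+ k * S.
  by rewrite mulrnAl ler_wMn2r // mulr_natl ler_wMn2r // ltW // ln_sublinear.
have : (ln C + ln K *+ k) * 1 <= (ln C + ln K *+ k) * S by rewrite ler_wpM2l //; lra.
by rewrite mulrnDl /A; lra.
Unshelve. all: end_near. Qed.

Lemma card_digit_prod_dvd_polylog (R : realType) (b : nat) (s x : R) :
  (1 < b)%N -> 0 <= s -> expR 1 <= x ->
  (#|` fset_set (digit_prod_dvd b x)|%fset)%:R <=
  (zeta b s + 1) * (((ln b%:R)^-1 + 2) * ln x) ^+ b *
  x `^ (1 + ((1 + s) * ln b%:R)^-1 * ln (zeta b s / b%:R)).
Proof.
move=> b1 s0 xe; set Z := zeta b s; set eta := 1 + _.
have Z1 : 1 <= Z by exact: zeta_ge1.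
have x0 : 0 < x by exact: lt_le_trans (expR_gt0 1) xe.
have L1 : 1 <= ln x by rewrite -(expRK 1) ler_ln ?posrE ?expR_gt0.
have x1 : 1 <= x by rewrite (le_trans _ xe) // ltW // expR_gt1.
have lnb : 0 < ln b%:R :> R by rewrite ln_gt0 // ltr1n.
have b0 : 0 < b%:R :> R by rewrite ltr0n ltnW.
(* So [b ^ k <= x < b ^ k.+1], and strings of at most [k.+1] digits suffice. *)
pose k := trunc_log b (Num.trunc x).
have bkx : (b%:R : R) ^+ k <= x.
  by rewrite -natrX -truncn_ge_nat ?(ltW x0) // trunc_logP // truncn_gt0.
have xbN : x < (b ^ k.+1)%:R by rewrite -truncn_lt_nat ?(ltW x0) // trunc_log_ltn.
have kL : k%:R <= ln x / ln b%:R.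
  rewrite ler_pdivlMr // mulr_natl -lnXn // ler_ln ?posrE //.
  by rewrite exprn_gt0.
have NK : k.+2%:R <= ((ln b%:R)^-1 + 2) * ln x.
  by rewrite mulrDl [_^-1 * _]mulrC -natr1 -natr1; lra.
apply: (le_trans (card_digit_prod_dvd_le R b k.+1 x s (x `^ (1 - eta)) b1
  (ltW x0) xbN s0 (powR_gt0 _ x0))).
rewrite -/Z.
have -> : x / x `^ (1 - eta) = x `^ eta.
  rewrite -{1}(powRr1 (ltW x0)) -powRB ?(gt_eqF x0) ?implybT //.
  by congr (_ `^ _); ring.
(* Only [Z ^+ k] is compared with a power of [x], because [b ^ k <= x]; the extra [Z] goes into the
   constant. *)
have ZN : Z ^+ k.+1 <= Z * x `^ (ln Z / ln b%:R).
  rewrite exprS ler_wpM2l //; first lra.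
  have -> : Z ^+ k = (b%:R ^+ k) `^ (ln Z / ln b%:R).
    rewrite -(powR_mulrn k (ltW b0)) -powRrM mulrC powRrM powR_mulrn ?powR_ge0 //.
    congr (_ ^+ _); rewrite /powR gt_eqF // divfK ?gt_eqF // lnK // posrE; lra.
  have q0 : 0 <= ln Z / ln b%:R by apply: divr_ge0; [exact: ln_ge0|exact: ltW].
  by rewrite ge0_ler_powR ?nnegrE ?exprn_ge0 ?(ltW x0) ?(ltW b0).
(* The balance that dictates [eta]: both halves of the count have the same power of [x]. *)
have etaE : (1 - eta) * s + ln Z / ln b%:R = eta.
  rewrite /eta ln_div ?posrE //; last lra.
  by field; rewrite gt_eqF // gt_eqF //; lra.
have yZ : (x `^ (1 - eta)) `^ s * (k.+1%:R * Z ^+ k.+1) <=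
    k.+1%:R * Z * x `^ eta.
  rewrite -powRrM mulrCA -[leRHS]mulrA ler_wpM2l //.
  rewrite -{2}etaE powRD ?(gt_eqF x0) ?implybT // mulrCA ler_wpM2l ?powR_ge0 //.
apply: (le_trans (lerD yZ (lexx _))); rewrite -mulrDl ler_wpM2r ?powR_ge0 //.
have N0 : 0 <= k.+2%:R :> R by [].
apply: (@le_trans _ _ ((Z + 1) * k.+2%:R ^+ b)); last first.
  by rewrite ler_wpM2l ?lerXn2r ?nnegrE //; lra.
rewrite mulrDl mul1r lerD2r mulrC ler_wpM2l //; first lra.
apply: (@le_trans _ _ (k.+2%:R ^+ 1)); first by rewrite expr1 ler_nat.
by rewrite ler_weXn2l ?ler1n // ltnW.
Qed.

Lemma card_digit_prod_dvd_lt_pow_o1 (R : realType) (b : nat) (s : R) :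
  (1 < b)%N -> 0 <= s ->
  lt_pow_o1 (fun x : R => (#|` fset_set (digit_prod_dvd b x)|%fset)%:R)
    (1 + ((1 + s) * ln b%:R)^-1 * ln (zeta b s / b%:R)).
Proof.
move=> b1 s0.
apply: (@lt_pow_o1_polylog R _ (zeta b s + 1) ((ln b%:R)^-1 + 2) _ b).
- by rewrite lerDr (le_trans ler01) // zeta_ge1.
- have : 0 < (ln b%:R)^-1 :> R by rewrite invr_gt0 ln_gt0 // ltr1n.
  lra.
- by move=> x; exact: card_digit_prod_dvd_polylog.
Qed.

Theorem theorem2p2 (R : realType) (b : nat) (hb : (3 <= b)%N) :
  ((4 <= b)%N -> exists! s : R, is_saddle b s) /\
  lt_pow_o1 (fun x : R => (#|` fset_set (digit_prod_dvd b x)|%fset)%:R) (eta_exp R b).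
Proof.
split; first exact: exists_unique_saddle.
rewrite /eta_exp; have b1 : (1 < b)%N by apply: leq_trans hb.
case: eqP => [->|b3].
  have Z3 : zeta 3 0 = 2 :> R.
    by rewrite /zeta big_ltn // big_nat1 oppr0 !powRr0.
  (* At [s = 0] the exponent is [1 + ln (2 / 3) / ln 3 = ln 2 / ln 3]. *)
  have := card_digit_prod_dvd_lt_pow_o1 R 3 0 isT (lexx 0).
  have ln3 : 0 < ln 3 :> R by rewrite ln_gt0 // ltr1n.
  rewrite Z3 ln_div ?posrE //; congr (lt_pow_o1 _ _).
  by field; rewrite gt_eqF.
have [s [sP _]] := exists_unique_saddle R b ltac:(lia).
(* Existence ensures that [xget] returns a genuine solution and not its default 0. *)
have [s0 _] : is_saddle b (saddle R b) by apply: (xgetPex 0); exists s.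
exact: card_digit_prod_dvd_lt_pow_o1 b1 (ltW s0).
Qed.
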